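(* Let $\psi:\mathbb{R}\to\mathbb{R}$ and let $\delta_{\psi}(\mathbf{X})=X_1-\psi(D)$ be a location equivariant estimator of $\theta_1$. Let $l^{(1)}(t)$ and $u^{(1)}(t)$ be functions (values $\pm\infty$ allowed) such that $l^{(1)}(t)\le m^{(1)}_{\lambda}(t)\le u^{(1)}(t)$ for all $\lambda\ge 0$ and any $t$. Define, for each $t$, $\psi^{*}(t)=\max\{l^{(1)}(t),\min\{\psi(t),u^{(1)}(t)\}\}$, and let $\delta_{\psi^{*}}(\mathbf{X})=X_1-\psi^{*}(D)$. If $P_{\boldsymbol\theta}[l^{(1)}(D)\le\psi(D)\le u^{(1)}(D)]<1$ for all $\boldsymbol\theta\in\Theta_0$, then, under the GPN criterion with a general loss function, $\delta_{\psi^{*}}$ is Pitman nearer to $\theta_1$ than $\delta_{\psi}$ over $\Theta_0$.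
   Context: $f$ is a specified Lebesgue probability density on $\mathbb{R}^2$, and $\mathbf{X}=(X_1,X_2)$ has joint p.d.f. $f(x_1-\theta_1,x_2-\theta_2)$, where $\boldsymbol\theta=(\theta_1,\theta_2)\in\Theta_0=\{(t_1,t_2)\in\mathbb{R}^2: t_1\le t_2\}$ is unknown. Put $\lambda=\theta_2-\theta_1\ge 0$, $D=X_2-X_1$, $Z_1=X_1-\theta_1$. The p.d.f. of $D$ is $f_D(t|\lambda)=\int_{-\infty}^{\infty}f(y,y+t-\lambda)\,dy$, and the conditional p.d.f. of $Z_1$ given $D=t$ is $f_\lambda(s|t)=f(s,s+t-\lambda)/f_D(t|\lambda)$ ($t$ in the support of $D$). $m^{(1)}_\lambda(t)$ denotes the median of this conditional distribution, so $\int_{-\infty}^{m^{(1)}_\lambda(t)}f(s,s+t-\lambda)\,ds=\frac12\int_{-\infty}^{\infty}f(s,s+t-\lambda)\,ds$. General loss function: $L_1(\boldsymbol\theta,a)=W(a-\theta_1)$, $a\in\mathbb{R}$, where $W:\mathbb{R}\to[0,\infty)$ satisfies $W(0)=0$, $W$ strictly decreasing on $(-\infty,0)$ and strictly increasing on $(0,\infty)$. GPN criterion: for estimators $\delta_1,\delta_2$ of $\theta_1$, $GPN(\delta_1,\delta_2;\boldsymbol\theta)=P_{\boldsymbol\theta}[L_1(\boldsymbol\theta,\delta_1)<L_1(\boldsymbol\theta,\delta_2)]+\frac12P_{\boldsymbol\theta}[L_1(\boldsymbol\theta,\delta_1)=L_1(\boldsymbol\theta,\delta_2)]$. $\delta_1$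 is (Pitman) nearer to $\theta_1$ than $\delta_2$ if $GPN(\delta_1,\delta_2;\boldsymbol\theta)\ge\frac12$ for all $\boldsymbol\theta\in\Theta_0$, with strict inequality for some $\boldsymbol\theta\in\Theta_0$. All functions defining estimators are understood to be Borel measurable.
   Formalization: The loss W is additionally assumed to have equal one-sided limits at 0 (W(0−)=W(0+)); without this, strict inequality can fail for every θ, e.g. for Z1 standard normal independent of D, l=u=0, ψ=−1 and W jumping to 10 only on the left of 0. *)

(* Defs.v *)
(* MathComp-Analysis *)
From HB Require Import structures.
From mathcomp Require Import all_boot all_order all_algebra.
From mathcomp Require Import all_classical all_reals all_analysis.
From mathcomp Require Import measurable_realfun.

Set Implicit Arguments.
Unset Strict Implicit.
Unset Printing Implicit Defensive.

Import Order.TTheory GRing.Theory Num.Theory.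
Import numFieldTopology.Exports numFieldNormedType.Exports.

Local Open Scope classical_set_scope.
Local Open Scope ring_scope.

Section model.
Context {R : realType}.
Notation mu := (@lebesgue_measure R).
(* [lebesgue_measure] lives on the copy [measurableTypeR R] of R carrying the
   Borel sigma-algebra; measurability on the plane is stated on the same copy. *)
Notation R2 := (measurableTypeR R * measurableTypeR R)%type.

Definition Theta0 : set (R * R) := [set th | th.1 <= th.2].

Definition is_pdf2 (f : R * R -> R) : Prop :=
  [/\ measurable_fun [set: R2] f,
      (forall x, 0 <= f x) &
      (\int[(mu \x mu)%E]_x (f x)%:E = 1)%E].

Definition has_location_density d (T : measurableType d)
    (P : R * R -> probability T R) (X : T -> R * R) (f : R * R -> R) : Prop :=
  measurable_fun [set: T] (X : T -> R2) /\
  forall th, Theta0 th -> forall A : set R2, measurable A ->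
    P th (X @^-1` A) =
    (\int[(mu \x mu)%E]_(x in A) (f (x.1 - th.1, x.2 - th.2))%:E)%E.

Definition pdfD (f : R * R -> R) (lam t : R) : \bar R :=
  (\int[mu]_y (f (y, y + t - lam))%:E)%E.

(* The points at which the conditional density below makes sense. The value
   +oo can occur, but only on a Lebesgue-null set of t. *)
Definition suppD (f : R * R -> R) (lam : R) : set R :=
  [set t | (0 < pdfD f lam t < +oo)%E].

Definition cond_pdfZ1 (f : R * R -> R) (lam t s : R) : R :=
  f (s, s + t - lam) / fine (pdfD f lam t).

Definition is_cond_median (f : R * R -> R) (lam t m : R) : Prop :=
  (\int[mu]_(s in `]-oo, m]) (cond_pdfZ1 f lam t s)%:E = (2^-1)%:E)%E.

Definition general_loss (W : R -> R) : Prop :=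
  [/\ (forall x, 0 <= W x), W 0 = 0,
      (forall x y, x < y -> y < 0 -> W y < W x) &
      (forall x y, 0 < x -> x < y -> W x < W y)].

Definition L1 (W : R -> R) (th : R * R) (a : R) : R := W (a - th.1).

Definition GPN d (T : measurableType d) (P : R * R -> probability T R)
    (X : T -> R * R) (W : R -> R) (d1 d2 : R * R -> R) (th : R * R) : \bar R :=
  (P th [set w | (L1 W th (d1 (X w)) < L1 W th (d2 (X w)))%R]
   + (2^-1)%:E * P th [set w | L1 W th (d1 (X w)) = L1 W th (d2 (X w))])%E.

Definition pitman_nearer d (T : measurableType d)
    (P : R * R -> probability T R) (X : T -> R * R) (W : R -> R)
    (d1 d2 : R * R -> R) : Prop :=
  (forall th, Theta0 th -> ((2^-1)%:E <= GPN P X W d1 d2 th)%E) /\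
  (exists2 th, Theta0 th & ((2^-1)%:E < GPN P X W d1 d2 th)%E).

Definition diff21 (x : R * R) : R := x.2 - x.1.

Definition delta (psi : R -> R) (x : R * R) : R := x.1 - psi (diff21 x).

(* When l t <= m <= u t for some real m, the clamped value is finite and [fine]
   is harmless; this covers every t in the support of D for some lam >= 0. *)
Definition psi_star (l u : R -> \bar R) (psi : R -> R) (t : R) : R :=
  fine (maxe (l t) (mine (psi t)%:E (u t))).

End model.

(* Main.v *)
(* Fix theta and condition on D = t.  If psi t lies outside [l t, u t], then psi*
   moves it to the nearer end point a, which lies between psi t and every
   conditional median of Z1.  Since W has equal one-sided limits at 0, the
   estimator with a has strictly smaller loss not only on the half-line beyond a
   but also for Z1 slightly before a; that larger half-line has conditional
   probability strictly above 1/2, because otherwise the continuous conditional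
   distribution function would reach 1/2 at a median on the wrong side of a.  If
   psi t lies in [l t, u t] the two estimators tie.  Integrating over t gives
   GPN >= 1/2, and equality would force D to lie almost surely where
   l <= psi <= u. *)
Require Import Defs.
From HB Require Import structures.
From mathcomp Require Import all_boot all_order all_algebra.
From mathcomp Require Import all_classical all_reals all_analysis.
From mathcomp Require Import measurable_realfun.
From mathcomp Require Import lra.

Set Implicit Arguments.
Unset Strict Implicit.
Unset Printing Implicit Defensive.

Import Order.TTheory GRing.Theory Num.Theory.
Import numFieldTopology.Exports numFieldNormedType.Exports.

Local Open Scope classical_set_scope.
Local Open Scope ring_scope.

(** * Translation invariance of Lebesgue measure and a shear of the plane *)

Section translation.
Context {R : realType}.
Notation mu := (@lebesgue_measure R).
Local Open Scope ereal_scope.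

(** The shifted measure agrees with [mu] on half-open intervals, and Lebesgue measure is the only
    measure with these values. *)
Lemma lebesgue_measureDr (c : R) (A : set R) : measurable A ->
  pushforward mu ((fun x => x + c)%R : R -> measurableTypeR R) A = mu A.
Proof.
have mc : measurable_fun [set: measurableTypeR R]
    ((fun x => x + c)%R : measurableTypeR R -> measurableTypeR R).
  by apply: measurable_funD => //; exact: measurable_cst.
pose mcf := isMeasurableFun.Build _ _ _ _ _ mc.
pose phi : {mfun measurableTypeR R >-> measurableTypeR R} := HB.pack
  ((fun x => x + c)%R : measurableTypeR R -> measurableTypeR R) mcf.
move=> mA; apply/esym.
apply: (@lebesgue_measure_unique _ (pushforward mu phi)) => //= _ [[a b]] _ <-.
rewrite /pushforward [X in _ = mu X](_ : _ = `](a - c)%R, (b - c)%R]%classic).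
  rewrite !lebesgue_measure_itv/= !lte_fin ltrD2r.
  by case: ifP => // _; rewrite -!EFinD opprB addrA subrK.
by apply/seteqP; split => x /=; rewrite !in_itv/= ltrBlDr lerBrDr.
Qed.

Lemma ge0_integral_translation (c : R) (h : R -> \bar R) :
  measurable_fun [set: measurableTypeR R] h -> (forall x, 0 <= h x) ->
  \int[mu]_x h x = \int[mu]_x h (x + c)%R.
Proof.
move=> mh h0.
have mc : measurable_fun [set: measurableTypeR R]
    ((fun x => x + c)%R : measurableTypeR R -> measurableTypeR R).
  by apply: measurable_funD => //; exact: measurable_cst.
have := @ge0_integral_pushforward _ _ _ _ R _ mc mu setT h measurableT mh.
rewrite preimage_setT => <- //.
by apply: eq_measure_integral => A mA _; exact/esym/lebesgue_measureDr.
Qed.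

Notation R1 := (measurableTypeR R).
Notation R2 := (measurableTypeR R * measurableTypeR R)%type.

Let shear_measurable (c : R) (g : R * R -> \bar R) :
  measurable_fun [set: R2] g ->
  measurable_fun [set: R2] ((fun x => g (x.1 + c, x.1 + c + x.2)%R) : R2 -> \bar R).
Proof.
move=> mg; apply: (measurableT_comp mg).
have mc : measurable_fun [set: R2] ((fun x => (x.1 + c)%R) : R2 -> R1).
  by apply: measurable_funD => //; exact: measurable_cst.
by apply/measurable_fun_pair => //; exact: measurable_funD.
Qed.

Lemma measurable_integral_shear (c : R) (g : R * R -> \bar R) :
  measurable_fun [set: R2] g -> (forall x, 0 <= g x) ->
  measurable_fun [set: R1] (fun t => \int[mu]_s g (s + c, s + c + t)%R).
Proof.
move=> mg g0.
exact: (@measurable_fun_fubini_tonelli_G _ _ R1 R1 R mu _ (shear_measurable c mg)).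
Qed.

(** With [c] equal to theta_1 this is the passage from X to (Z1, D). Tonelli reduces the shear to
    translations of the line, by [c] outside and by [s + c] inside; a second use of Tonelli makes D
    the outer variable. *)
Lemma ge0_integral_shear (c : R) (g : R * R -> \bar R) :
  measurable_fun [set: R2] g -> (forall x, 0 <= g x) ->
  \int[(mu \x mu)%E]_x g x =
  \int[mu]_t \int[mu]_s g (s + c, s + c + t)%R.
Proof.
move=> mg g0.
rewrite (@fubini_tonelli1 _ _ R1 R1 R mu mu g mg g0).
have mg' := shear_measurable c mg.
transitivity (\int[mu]_s \int[mu]_t g (s + c, s + c + t)%R).
  rewrite (ge0_integral_translation c (h := fubini_F mu g)).
  - apply: eq_integral => s _; rewrite /fubini_F.
    rewrite (ge0_integral_translation (s + c)%R (h := fun y => g (s + c, y)%R))//.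
      by apply: eq_integral => y _; rewrite (addrC y).
    exact: (measurableT_comp mg (@pair1_measurable _ _ R1 R1 (s + c)%R)).
  - exact: (@measurable_fun_fubini_tonelli_F _ _ R1 R1 R mu g mg).
  - by move=> s; exact: integral_ge0.
by rewrite (@fubini_tonelli _ _ R1 R1 R mu mu _ mg').
Qed.

End translation.

(** * Medians of an absolutely continuous law on the line *)

Section median.
Context {R : realType}.
Notation mu := (@lebesgue_measure R).
Notation R1 := (measurableTypeR R).
Variable q : R -> R.
Hypothesis mq : measurable_fun [set: R1] q.
Hypothesis q0 : forall x, 0 <= q x.
Hypothesis q1 : (\int[mu]_x (q x)%:E = 1)%E.

(** The distribution function of [q], taken real-valued so that the intermediate value theorem
    applies. *)
Let F (x : R) : R := \int[mu]_(s in `]-oo, x]) q s.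

Let intq (A : set R) : measurable A -> mu.-integrable A (EFin \o q).
Proof.
move=> mA; apply: (@integrableS _ _ _ mu setT) => //.
apply/integrableP; split; first exact/measurable_EFinP.
under eq_integral do rewrite /= ger0_norm//.
by rewrite q1 ltry.
Qed.

Let FE x : (\int[mu]_(s in `]-oo, x]) (q s)%:E = (F x)%:E)%E.
Proof.
by rewrite /F /Rintegral fineK//; apply: integrable_fin_num => //; exact: intq.
Qed.

Let F_split x y : x <= y -> F y = F x + \int[mu]_(s in `]x, y]) q s.
Proof.
move=> xy; rewrite /F (@itv_bndbnd_setU _ _ -oo%O (BRight x))//.
rewrite Rintegral_setU//=.
  by rewrite -itv_bndbnd_setU//; exact: intq.
apply/disj_set2P; rewrite -subset0 => z/=; rewrite !in_itv/= => -[zx /andP[]].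
by rewrite ltNge zx.
Qed.

(** Absolute continuity of the integral: an increment of [F] is the integral of [q] over an
    interval, hence small when the interval is short. *)
Let F_continuous : continuous F.
Proof.
move=> x; apply/cvgrPdist_lt => e e0.
have [d [d0 hd]] := integral_normr_continuous (intq measurableT) e0.
have key (a b : R) : a <= b -> b - a < d -> `|F b - F a| < e.
  move=> ab bad; rewrite (F_split ab) addrC addKr.
  have := hd _ (measurable_itv `]a, b]); rewrite /=.
  rewrite lebesgue_measure_itv/= lte_fin.
  have -> : (if (a < b)%R then b%:E - a%:E else 0)%E = (b - a)%:E.
    by have [//|ba] := ltP a b; rewrite (@le_anti _ _ a b) ?ab// subrr.
  rewrite lte_fin => /(_ bad).
  under eq_Rintegral do rewrite ger0_norm//.
  by rewrite ger0_norm//; exact: Rintegral_ge0.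
exists d => //= y /=; have [xy|yx] := leP x y => dxy.
  by rewrite distrC key// (le_lt_trans _ dxy)// distrC ler_norm.
by rewrite key ?(ltW yx)// (le_lt_trans _ dxy)// ler_norm.
Qed.

Let F_compl x : (\int[mu]_(s in `]x, +oo[) (q s)%:E = (1 - F x)%:E)%E.
Proof.
have : (\int[mu]_(s in `]x, +oo[) (q s)%:E + (F x)%:E = 1)%E.
  rewrite -FE -q1 addeC -ge0_integral_setU//=.
  - by rewrite -itv_bndbnd_setU//= set_itvNyy.
  - by rewrite -itv_bndbnd_setU//= set_itvNyy; exact/measurable_EFinP.
  - by move=> s _; rewrite lee_fin.
  - apply/disj_set2P; rewrite -subset0 => z/=; rewrite !in_itv/= => -[zx].
    by rewrite andbT ltNge zx.
have : (\int[mu]_(s in `]x, +oo[) (q s)%:E)%E \is a fin_num.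
  by apply: integrable_fin_num => //; exact: intq.
case: (integral _ _ _) => // r _.
by rewrite -EFinD => -[<-]; rewrite addrK.
Qed.

(** The intervals [[-n, n]] exhaust the line, so one of them has mass above 1/2. Every ray
    containing it has mass above 1/2, and every lower ray ending before it has mass below 1/2. *)
Let F_tails :
  exists n : R, forall x, (x < - n -> F x < 2^-1) /\ (n < x -> 2^-1 < F x).
Proof.
have := @ge0_nondecreasing_set_cvg_integral _ R1 R
  (fun n : nat => `[- n%:R, n%:R]%classic) (EFin \o q) mu.
have -> : \bigcup_n `[- n%:R, n%:R]%classic = [set: R].
  apply/seteqP; split => // x _; exists (Num.bound `|x|) => //=.
  by rewrite in_itv/= -ler_norml ltW// archi_boundP.
rewrite q1 => cv.
have {}cv : (\int[mu]_(x in `[(- n%:R)%R, n%:R%R]) (q x)%:E)%E @[n --> \oo]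
    --> (1%:E : \bar R).
  apply: cv => //.
  - move=> m n mn; apply/subsetPset => x /=; rewrite !in_itv/= -!ler_norml.
    by move=> /le_trans; apply; rewrite ler_nat.
  - by move=> i; apply/measurable_EFinP; exact: measurable_funTS.
  - by move=> i x _; rewrite lee_fin.
have half1 : ((2^-1)%:E < 1 :> \bar R)%E by rewrite lte_fin; lra.
have [n _ hn] := cv _ (open_ereal_gt' half1).
have {hn} := hn n (leqnn n); rewrite /= => hn.
exists n%:R => x.
have sub (A : set R) : measurable A -> `[- n%:R, n%:R] `<=` A ->
    ((2^-1)%:E < \int[mu]_(s in A) (q s)%:E)%E.
  move=> mA sA; apply: (lt_le_trans hn); apply: ge0_subset_integral => //.
    by apply/measurable_EFinP; exact: measurable_funTS.
  by move=> s _; rewrite lee_fin.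
split=> hx; last first.
  rewrite -lte_fin -FE; apply: sub => // s /=; rewrite !in_itv/= => /andP[_ sn].
  exact: le_trans sn (ltW hx).
have : ((2^-1)%:E < \int[mu]_(s in `]x, +oo[) (q s)%:E)%E.
  apply: sub => // s /=; rewrite !in_itv/= => /andP[ns _].
  by rewrite andbT (lt_le_trans hx).
by rewrite F_compl lte_fin; lra.
Qed.

(** Intermediate value theorem for [F] between a point of the left tail and [x]. *)
Lemma exists_median_le x :
  ((2^-1)%:E <= \int[mu]_(s in `]-oo, x]) (q s)%:E)%E ->
  exists2 m, m <= x & (\int[mu]_(s in `]-oo, m]) (q s)%:E = (2^-1)%:E)%E.
Proof.
(* The point [- n - 1] is strictly inside the left tail; the minimum with [x] makes it a valid left
   end point. *)
rewrite FE lee_fin => hx; have [n /(_ (Num.min x (- n - 1)))[hn _]] := F_tails.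
set y := Num.min _ _ in hn.
have yx : y <= x by rewrite /y ge_min lexx.
have {}hn : F y < 2^-1.
  by apply: hn; rewrite /y; have [] := leP x (- n - 1) => ?; lra.
have [|m + Fm] := @IVT _ F y x 2^-1 yx (continuous_subspaceT F_continuous).
  by rewrite ge_min le_max (ltW hn) hx orbT.
by rewrite in_itv/= => /andP[_ mx]; exists m => //; rewrite FE Fm.
Qed.

Lemma exists_median_ge x :
  (\int[mu]_(s in `]-oo, x]) (q s)%:E <= (2^-1)%:E)%E ->
  exists2 m, x <= m & (\int[mu]_(s in `]-oo, m]) (q s)%:E = (2^-1)%:E)%E.
Proof.
rewrite FE lee_fin => hx; have [n /(_ (Num.max x (n + 1)))[_ hn]] := F_tails.
set y := Num.max _ _ in hn.
have xy : x <= y by rewrite /y le_max lexx.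
have {}hn : 2^-1 < F y.
  by apply: hn; rewrite /y; have [] := leP x (n + 1) => ?; lra.
have [|m + Fm] := @IVT _ F x y 2^-1 xy (continuous_subspaceT F_continuous).
  by rewrite ge_min le_max (ltW hn) hx orbT.
by rewrite in_itv/= => /andP[xm _]; exists m => //; rewrite FE Fm.
Qed.

Lemma exists_median :
  exists m, (\int[mu]_(s in `]-oo, m]) (q s)%:E = (2^-1)%:E)%E.
Proof.
have [/exists_median_ge|/ltW/exists_median_le] :=
    leP (\int[mu]_(s in `]-oo, 0%R]) (q s)%:E)%E (2^-1)%:E;
  by move=> [m _ qm]; exists m.
Qed.

(** Otherwise some median would lie at or beyond [x]. Medians need not be unique, since [q] may
    vanish on an interval, so the assumption ranges over all of them. *)
Lemma lower_ray_gt_half x :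
  (forall m, (\int[mu]_(s in `]-oo, m]) (q s)%:E = (2^-1)%:E)%E -> m < x) ->
  ((2^-1)%:E < \int[mu]_(s in `]-oo, x]) (q s)%:E)%E.
Proof.
move=> hx; rewrite ltNge; apply/negP => /exists_median_ge[m xm /hx].
by rewrite ltNge xm.
Qed.

Lemma upper_ray_gt_half x :
  (forall m, (\int[mu]_(s in `]-oo, m]) (q s)%:E = (2^-1)%:E)%E -> x < m) ->
  ((2^-1)%:E < \int[mu]_(s in `]x, +oo[) (q s)%:E)%E.
Proof.
move=> hx; have : (\int[mu]_(s in `]-oo, x]) (q s)%:E < (2^-1)%:E)%E.
  rewrite ltNge; apply/negP => /exists_median_le[m mx /hx].
  by rewrite ltNge mx.
by rewrite FE F_compl !lte_fin; lra.
Qed.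

End median.

(** * Almost everywhere equality from a comparison of integrals *)

(** The difference [f2 - f1] is almost everywhere nonnegative with integral at most 0, so it
    vanishes almost everywhere. Integrability makes both functions finite almost everywhere, which
    lets the subtraction be undone. *)
Lemma integral_le_ae_eq d (T : measurableType d) (R : realType)
    (mu : {measure set T -> \bar R}) (f1 f2 : T -> \bar R) :
  mu.-integrable [set: T] f1 -> mu.-integrable [set: T] f2 ->
  {ae mu, forall x, f1 x <= f2 x}%E ->
  (\int[mu]_x f2 x <= \int[mu]_x f1 x)%E ->
  {ae mu, forall x, f1 x = f2 x}.
Proof.
move=> i1 i2 f12 int21.
have ik : mu.-integrable [set: T] (f2 \- f1)%E by exact: integrableB.
have mk := measurable_int _ ik.
have absk : (\int[mu]_x `|(f2 \- f1) x| = \int[mu]_x (f2 \- f1) x)%E.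
  apply: ae_eq_integral => //; first exact: measurableT_comp.
  have := integrable_ae measurableT i1.
  apply: filterS2 f12 => x le12 /(_ I) fin1 _ /=.
  by rewrite gee0_abs// sube_ge0// fin1.
have : (\int[mu]_x `|(f2 \- f1) x| = 0)%E.
  apply/eqP; rewrite eq_le integral_ge0 ?andbT; last by [].
  rewrite absk integralB//.
  by rewrite leeBlDr ?integrable_fin_num// add0e.
move/(ae_eq_integral_abs mu measurableT mk).1.
have := integrable_ae measurableT i1; have := integrable_ae measurableT i2.
apply: filterS3 => x /(_ I) fin2 /(_ I) fin1 /(_ I) /= k0.
move: fin1 fin2 k0; case: (f1 x) => // r1 _; case: (f2 x) => // r2 _.
by rewrite -EFinB => -[/subr0_eq ->].
Qed.


(** * Measurability of the loss and its behaviour under shifts *)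

Section loss.
Context {R : realType}.
Notation R1 := (measurableTypeR R).
Variable W : R -> R.
Hypothesis W_loss : general_loss W.

(** Reflection carries results about positive shifts over to negative ones. *)
Lemma general_loss_opp : general_loss (fun x => W (- x)).
Proof.
have [W0 W00 Wd Wi] := W_loss; split => // [|x y xy y0|x y x0 xy].
- by rewrite oppr0.
- by apply: Wi; [rewrite oppr_gt0|rewrite ltrN2].
- by apply: Wd; [rewrite ltrN2|rewrite oppr_lt0].
Qed.

Lemma general_loss_gt0 x : 0 < x -> 0 < W x.
Proof.
have [W0 _ _ Wi] := W_loss => x0.
by apply: (le_lt_trans (W0 (x / 2))); apply: Wi; lra.
Qed.

(** [W] is the sum of a nondecreasing part carried by the positive half-line and a nonincreasing
    part carried by the negative one. *)
Lemma measurable_general_loss : measurable_fun [set: R1] W.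
Proof.
have [W0 W00 Wd Wi] := W_loss.
pose g x := if 0 < x then W x else 0.
pose h x := if x < 0 then W x else 0.
have -> : W = g \+ h.
  apply/funext => x; rewrite /g /h /=.
  by have [_|_|->] := ltgtP x 0; rewrite ?W00 ?addr0 ?add0r.
apply: measurable_funD.
  apply: nondecreasing_measurable; first exact: measurableT.
  move=> x y xy; rewrite /g.
  case: ifPn => x0; last by case: ifPn.
  rewrite (lt_le_trans x0 xy); move: xy; rewrite le_eqVlt => /predU1P[->//|xy].
  exact/ltW/Wi.
apply: nonincreasing_measurable; first exact: measurableT.
move=> x y xy; rewrite /h.
case: ifPn => y0; last by case: ifPn.
rewrite (le_lt_trans xy y0); move: xy; rewrite le_eqVlt => /predU1P[->//|xy].
exact/ltW/Wd.
Qed.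

(* W exceeds its punctured limit at 0 everywhere on the right, so a slightly
   negative argument still costs less than a given positive one. *)
Lemma general_loss_shift_right (a : R) : (exists c : R, W x @[x --> 0^'] --> c) ->
  0 < a -> exists2 e, 0 < e & forall z, - e < z -> W z < W (z + a).
Proof.
move=> [c Wc] a0; have [W0 W00 Wd Wi] := W_loss.
(* If [W (x / 2)] were below [c], values of [W] close to 0 would exceed it, against monotonicity to
   the right of 0. The passage from [x / 2] to [x] makes the inequality strict. *)
have c_lt x : 0 < x -> c < W x.
  move=> x0; apply: (@le_lt_trans _ _ (W (x / 2))); last by apply: Wi; lra.
  rewrite leNgt; apply/negP => Wxc.
  have /cvgr_gt /(_ _ Wxc) [e /= e0 he] := Wc.
  pose y := Num.min (x / 4) (e / 2).
  have y0 : 0 < y by rewrite /y lt_min; apply/andP; split; lra.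
  have : W (x / 2) < W y.
    apply: he => /=; last by rewrite gt_eqF.
    rewrite sub0r normrN gtr0_norm// gt_min; apply/orP; right; lra.
  rewrite ltNge => /negP; apply; apply/ltW/Wi => //.
  by rewrite /y gt_min; apply/orP; left; lra.
have a2 : 0 < a / 2 by lra.
have /cvgr_lt /(_ _ (c_lt _ a2)) [e /= e0 he] := Wc.
(* For negative [z] the value [a / 2] separates the two losses: [e] gives [W z < W (a / 2)], and
   [z > - a / 2] gives [a / 2 < z + a]. *)
exists (Num.min e (a / 2)); first by rewrite lt_min e0.
move=> z; rewrite ltrNl lt_min => /andP[ze za].
have [z0|z0|->] := ltgtP z 0.
- apply: (@lt_trans _ _ (W (a / 2))); last by apply: Wi => //; lra.
  apply: he => /=; last by rewrite lt_eqF.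
  by rewrite sub0r normrN ltr0_norm.
- by apply: Wi => //; lra.
- by rewrite W00 add0r; exact: general_loss_gt0.
Qed.

End loss.

Lemma general_loss_shift_left (R : realType) (W : R -> R) (a : R) :
  general_loss W -> (exists c : R, W x @[x --> 0^'] --> c) ->
  0 < a -> exists2 e, 0 < e & forall z, z < e -> W z < W (z - a).
Proof.
move=> Wl [c Wc] a0.
have [|e e0 he] := general_loss_shift_right (general_loss_opp Wl) _ a0.
  exists c; apply/cvgrPdist_lt => e e0.
  have /cvgrPdist_lt /(_ e e0) [r /= r0 hr] := Wc.
  exists r => //= x /= xr x0; apply: hr; rewrite /= ?oppr_eq0//.
  by rewrite opprK add0r; move: xr; rewrite sub0r normrN.
exists e => // z ze.
by have := he (- z); rewrite ltrN2 opprD !opprK; exact.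
Qed.

(** * Comparison of the two estimators given D = t *)

Section conditional.
Context {R : realType}.
Notation mu := (@lebesgue_measure R).
Notation R1 := (measurableTypeR R).
Notation R2 := (measurableTypeR R * measurableTypeR R)%type.
Variables (f : R * R -> R) (lam t : R).
Hypothesis f_pdf : is_pdf2 f.
Hypothesis t_supp : suppD f lam t.

(** The joint density of (Z1, D) along D = t; its normalisation is the conditional density [q]
    below. *)
Let g (s : R) := f (s, s + t - lam).
Let p := fine (pdfD f lam t).

Lemma measurable_pdf2_row : measurable_fun [set: R1] g.
Proof.
have [mf _ _] := f_pdf; apply: (measurableT_comp mf).
apply/measurable_fun_pair => //.
by apply: measurable_funB; [exact: measurable_funD|exact: measurable_cst].
Qed.

Let p_gt0 : 0 < p.
Proof. exact: fine_gt0. Qed.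

Let pE : pdfD f lam t = p%:E.
Proof.
by rewrite /p fineK// ge0_fin_numE; [case/andP: t_supp|case/andP: t_supp => /ltW].
Qed.

Let q := cond_pdfZ1 f lam t.

Let q0 s : 0 <= q s.
Proof. by have [_ f0 _] := f_pdf; rewrite /q /cond_pdfZ1 divr_ge0// ltW. Qed.

Let mq : measurable_fun [set: R1] q.
Proof. by apply: measurable_funM; [exact: measurable_pdf2_row|exact: measurable_cst]. Qed.

Let integral_row (A : set R) : measurable (A : set R1) ->
  (\int[mu]_(s in A) (g s)%:E = p%:E * \int[mu]_(s in A) (q s)%:E)%E.
Proof.
move=> mA; rewrite -ge0_integralZl_EFin//; last exact/ltW.
- apply: eq_integral => s _.
  by rewrite -EFinM /q /cond_pdfZ1 mulrC divfK// gt_eqF.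
- by move=> s _; rewrite lee_fin.
- by apply/measurable_EFinP; exact: measurable_funTS.
Qed.

Let q1 : (\int[mu]_s (q s)%:E = 1)%E.
Proof.
have := integral_row measurableT; rewrite -/(pdfD f lam t) pE.
have : (0 <= \int[mu]_s (q s)%:E)%E by apply: integral_ge0 => s _; rewrite lee_fin.
case: (integral _ _ _) => [r _|_|//].
  rewrite -EFinM => -[/esym pr]; congr EFin.
  by apply: (mulfI (lt0r_neq0 p_gt0)); rewrite pr mulr1.
(* An infinite integral of [q] would make the finite number [p] infinite. *)
by rewrite gt0_muley// lte_fin.
Qed.

Lemma exists_cond_median : exists m, is_cond_median f lam t m.
Proof. exact: exists_median mq q0 q1. Qed.

(** Multiplies a conditional probability by the density of D, giving the form that is later
    integrated over t. *)
Let half_lt (A : set R) : measurable (A : set R1) ->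
  ((2^-1)%:E < \int[mu]_(s in A) (q s)%:E)%E ->
  ((2^-1)%:E * pdfD f lam t < \int[mu]_(s in A) (g s)%:E)%E.
Proof.
move=> mA hA; rewrite integral_row// pE muleC.
by rewrite lte_pmul2l// ?fin_num_fun// lte_fin.
Qed.

Let row_mono (A B : set R) : measurable (A : set R1) -> measurable (B : set R1) ->
  A `<=` B -> (\int[mu]_(s in A) (g s)%:E <= \int[mu]_(s in B) (g s)%:E)%E.
Proof.
have [_ f0 _] := f_pdf.
move=> mA mB AB; apply: ge0_subset_integral => //.
- by apply/measurable_EFinP; apply: measurable_funTS; exact: measurable_pdf2_row.
- by move=> s _; rewrite lee_fin; exact: f0.
Qed.

(** The margin [e] puts [a - e] strictly below every median, even if [a] is itself a median; this is
    what makes the bound strict. *)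
Lemma above_half_row (a e : R) (N : set R) :
  (forall m, is_cond_median f lam t m -> a <= m) -> 0 < e ->
  measurable (N : set R1) -> `]a - e, +oo[ `<=` N ->
  ((2^-1)%:E * pdfD f lam t < \int[mu]_(s in N) (g s)%:E)%E.
Proof.
move=> am e0 mN aN; apply: (lt_le_trans _ (row_mono _ mN aN)) => //.
apply: half_lt => //; apply: upper_ray_gt_half => // m /am; lra.
Qed.

Lemma below_half_row (a e : R) (N : set R) :
  (forall m, is_cond_median f lam t m -> m <= a) -> 0 < e ->
  measurable (N : set R1) -> `]-oo, a + e[ `<=` N ->
  ((2^-1)%:E * pdfD f lam t < \int[mu]_(s in N) (g s)%:E)%E.
Proof.
move=> ma e0 mN aN.
(* Lower rays are closed in the median lemmas, whereas [N] is only known to contain the open ray;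
   half of the margin fits a closed ray inside. *)
have aN' : `]-oo, a + e / 2] `<=` N.
  by apply: subset_trans aN => s /=; rewrite !in_itv/=; lra.
apply: (lt_le_trans _ (row_mono _ mN aN')) => //.
apply: half_lt => //; apply: lower_ray_gt_half => // m /ma; lra.
Qed.

Variables (W : R -> R) (l u : R -> \bar R) (psi : R -> R).
Hypothesis W_loss : general_loss W.
Hypothesis W_lim0 : exists c : R, W x @[x --> 0^'] --> c.
Hypothesis l_u_bounds :
  forall m, is_cond_median f lam t m -> (l t <= m%:E <= u t)%E.

Let a := psi_star l u psi t.
Let b := psi t.

(** Given D = t and Z1 = s, the estimation errors are [s - a] for the clamped estimator and [s - b]
    for the original one. *)
Let nearer := [set s | W (s - a) < W (s - b)].

Lemma measurable_nearer (x y : R) :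
  measurable ([set s | W (s - x) < W (s - y)] : set R1).
Proof.
have mW x' : measurable_fun [set: R1] (fun s => W (s - x')).
  apply: (measurableT_comp (measurable_general_loss W_loss)).
  by apply: measurable_funB => //; exact: measurable_cst.
have := measurable_fun_ltr (mW x) (mW y) measurableT.
by move=> /(_ [set true]); rewrite setTI; apply.
Qed.

Lemma psi_star_id : (l t <= b%:E <= u t)%E -> a = b.
Proof.
by case/andP => lb bu; rewrite /a /psi_star (min_idPl bu) (max_idPr lb).
Qed.

Lemma psi_star_nearer : ~~ (l t <= b%:E <= u t)%E ->
  ((2^-1)%:E * pdfD f lam t < \int[mu]_(s in nearer) (g s)%:E)%E.
Proof.
(* One median between [l t] and [u t] orders these bounds; with [b] on the other side it makes the
   end point reached by clamping finite. *)
have [m0 /l_u_bounds/andP[lm0 m0u]] := exists_cond_median.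
have mN := measurable_nearer a b.
rewrite negb_and -!ltNge => /orP[bl|ub].
- have bu : (b%:E <= u t)%E by rewrite (le_trans (ltW bl))// (le_trans lm0).
  have aE : l t = a%:E.
    rewrite /a /psi_star (min_idPl bu) (max_idPl (ltW bl)) fineK//.
    by rewrite fin_numElt (lt_trans _ bl) ?ltNyr// (le_lt_trans lm0) ?ltry.
  have ba : 0 < a - b by move: bl; rewrite aE lte_fin subr_gt0.
  have [e e0 he] := general_loss_shift_right W_loss W_lim0 ba.
  apply: (above_half_row (a := a) _ e0 mN) => [m /l_u_bounds|s /=].
    by rewrite aE lee_fin => /andP[].
  (* The shift is by [a - b], so the errors [s - a] and [s - b] are [z] and [z + (a - b)]. *)
  rewrite in_itv/= andbT => es; have := he (s - a); rewrite addrA subrK; apply.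
  by move: es; rewrite ltrBlDr; lra.
- have lu : (l t <= u t)%E by rewrite (le_trans lm0).
  have aE : u t = a%:E.
    rewrite /a /psi_star (min_idPr (ltW ub)) (max_idPr lu) fineK//.
    by rewrite fin_numElt (lt_trans ub) ?ltry// andbT (lt_le_trans _ m0u) ?ltNyr.
  have ba : 0 < b - a by move: ub; rewrite aE lte_fin subr_gt0.
  have [e e0 he] := general_loss_shift_left W_loss W_lim0 ba.
  apply: (below_half_row (a := a) _ e0 mN) => [m /l_u_bounds|s /=].
    by rewrite aE lee_fin => /andP[].
  rewrite in_itv/= => es; have := he (s - a).
  by rewrite opprB addrA subrK; apply; rewrite ltrBlDl.
Qed.

End conditional.

(** * Integration over the values of D for a fixed theta *)

Section law.
Context {R : realType}.
Notation mu := (@lebesgue_measure R).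
Notation R1 := (measurableTypeR R).
Notation R2 := (measurableTypeR R * measurableTypeR R)%type.
Context d (T : measurableType d) (P : R * R -> probability T R) (X : T -> R * R).
Variables (f : R * R -> R) (th : R * R).
Hypothesis f_pdf : is_pdf2 f.
Hypothesis X_density : has_location_density P X f.
Hypothesis th0 : Theta0 th.

Let lam := th.2 - th.1.

(* The values s of Z1 for which X lies in A, given D = t. *)
Definition fiber (A : set (R * R)) (t : R) : set R :=
  [set s | A (s + th.1, s + th.1 + t)].

(** The density in t of the joint event that X lies in [A] and D is near t. It is left unnormalised
    to avoid dividing by the density of D, which is the case where [A] is the whole plane. *)
Definition fiber_mass (A : set (R * R)) (t : R) : \bar R :=
  (\int[mu]_(s in fiber A t) (f (s, s + t - lam))%:E)%E.

Let g (A : set (R * R)) : R * R -> \bar R :=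
  (fun x => (f (x.1 - th.1, x.2 - th.2))%:E) \_ A.

Let g0 A x : (0 <= g A x)%E.
Proof.
by rewrite /g patchE; case: ifP => // _; rewrite lee_fin; case: f_pdf.
Qed.

Let mg (A : set (R * R)) : measurable (A : set R2) ->
  measurable_fun [set: R2] (g A).
Proof.
have [mf _ _] := f_pdf => mA; apply/(measurable_restrictT _ mA).
apply: measurable_funTS; apply/measurable_EFinP; apply: (measurableT_comp mf).
by apply/measurable_fun_pair; apply: measurable_funB => //; exact: measurable_cst.
Qed.

Let fiber_massE A t :
  fiber_mass A t = (\int[mu]_s g A (s + th.1, s + th.1 + t)%R)%E.
Proof.
rewrite /fiber_mass integral_mkcond; apply: eq_integral => s _.
rewrite /g !patchE /= addrK.
have -> : s + th.1 + t - th.2 = s + t - lam by rewrite /lam; lra.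
by [].
Qed.

Lemma fiber_mass_ge0 A t : (0 <= fiber_mass A t)%E.
Proof. by rewrite fiber_massE; exact: integral_ge0. Qed.

Lemma measurable_fiber_mass (A : set (R * R)) : measurable (A : set R2) ->
  measurable_fun [set: R1] (fiber_mass A).
Proof.
move=> mA; have -> := funext (fiber_massE A).
exact: (measurable_integral_shear th.1 (mg mA)).
Qed.

Lemma law_fiber_mass (A : set (R * R)) : measurable (A : set R2) ->
  P th (X @^-1` A) = (\int[mu]_t fiber_mass A t)%E.
Proof.
move=> mA; have [_ PX] := X_density; rewrite PX// integral_mkcond.
rewrite (ge0_integral_shear th.1 (mg mA))//.
by apply: eq_integral => t _; rewrite fiber_massE.
Qed.

(** Its integral is a probability, hence finite. *)
Lemma integrable_fiber_mass (A : set (R * R)) : measurable (A : set R2) ->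
  mu.-integrable [set: R1] (fiber_mass A).
Proof.
move=> mA; apply/integrableP; split; first exact: measurable_fiber_mass.
under eq_integral do rewrite gee0_abs ?fiber_mass_ge0//.
rewrite -law_fiber_mass// (le_lt_trans _ (ltry 1))//.
apply: probability_le1; have [mX _] := X_density.
by rewrite -[X in measurable X]setTI; exact: mX.
Qed.

Variables (W : R -> R) (l u : R -> \bar R) (psi : R -> R).
Hypothesis W_loss : general_loss W.
Hypothesis W_lim0 : exists c : R, W x @[x --> 0^'] --> c.
Hypothesis psi_meas : measurable_fun [set: R1] psi.
Hypothesis l_meas : measurable_fun [set: R1] l.
Hypothesis u_meas : measurable_fun [set: R1] u.
Hypothesis l_u_bounds : forall t m, suppD f lam t ->
  is_cond_median f lam t m -> (l t <= m%:E <= u t)%E.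
Hypothesis psi_out : (P th [set w | (l (diff21 (X w)) <= (psi (diff21 (X w)))%:E
                       <= u (diff21 (X w)))%E] < 1)%E.

Let psi' := psi_star l u psi.

Let measurable_diff21 : measurable_fun [set: R2] (@diff21 R).
Proof. by apply: measurable_funB. Qed.

Let measurable_psi_star : measurable_fun [set: R1] psi'.
Proof.
apply: (measurableT_comp (fine_measurable measurableT)).
apply: measurable_maxe => //; apply: measurable_mine => //.
exact/measurable_EFinP.
Qed.

Let measurable_loss (phi : R -> R) : measurable_fun [set: R1] phi ->
  measurable_fun [set: R2] (fun x => L1 W th (delta phi x)).
Proof.
move=> mphi; apply: (measurableT_comp (measurable_general_loss W_loss)).
apply: measurable_funB; last exact: measurable_cst.
by apply: measurable_funB => //; exact: (measurableT_comp mphi).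
Qed.

Let lossE (phi : R -> R) s t :
  L1 W th (delta phi (s + th.1, s + th.1 + t)) = W (s - phi t).
Proof.
rewrite /L1 /delta /diff21/=.
have -> : s + th.1 + t - (s + th.1) = t by lra.
by congr (W _); lra.
Qed.

Let N : set (R * R) :=
  [set x | L1 W th (delta psi' x) < L1 W th (delta psi x)].
Let E : set (R * R) :=
  [set x | L1 W th (delta psi' x) = L1 W th (delta psi x)].
Let S : set R := [set t | ~~ (l t <= (psi t)%:E <= u t)%E].

Let mN : measurable (N : set R2).
Proof.
have := measurable_fun_ltr (measurable_loss measurable_psi_star)
  (measurable_loss psi_meas) measurableT.
by move=> /(_ [set true]); rewrite setTI; apply.
Qed.

Let mE : measurable (E : set R2).
Proof.
have := measurable_fun_eqr (measurable_loss measurable_psi_star)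
  (measurable_loss psi_meas) measurableT.
move=> /(_ [set true]); rewrite setTI => /(_ I).
by congr measurable; apply/seteqP; split=> x /= /eqP.
Qed.

Let mS : measurable (S : set R1).
Proof.
have mpsi : measurable_fun [set: R1] (EFin \o psi) by exact/measurable_EFinP.
have := measurable_and (measurable_fun_lee l_meas mpsi)
  (measurable_fun_lee mpsi u_meas) measurableT.
move=> /(_ [set false]); rewrite setTI => /(_ I).
by congr measurable; apply/seteqP; split=> t /= /negP/negP//; move=> /negbTE.
Qed.

(** The GPN given D = t, multiplied by the density of D at t. *)
Let h t := (fiber_mass N t + (2^-1)%:E * fiber_mass E t)%E.

Let GPN_h : GPN P X W (delta psi') (delta psi) th = (\int[mu]_t h t)%E.
Proof.
rewrite /GPN -/(X @^-1` N) -/(X @^-1` E) !law_fiber_mass//.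
have mfN := measurable_fiber_mass mN; have mfE := measurable_fiber_mass mE.
rewrite /h [RHS]ge0_integralD//.
- by rewrite ge0_integralZl_EFin// => t _; exact: fiber_mass_ge0.
- by move=> t _; exact: fiber_mass_ge0.
- by move=> t _; rewrite mule_ge0// ?lee_fin ?fiber_mass_ge0.
- exact: emeasurable_funM.
Qed.

Let integrable_h : mu.-integrable [set: R1] h.
Proof.
apply: integrableD => //; first exact: integrable_fiber_mass.
by apply: integrableZl => //; exact: integrable_fiber_mass.
Qed.

Let h_gt_half t : suppD f lam t -> S t ->
  ((2^-1)%:E * pdfD f lam t < h t)%E.
Proof.
move=> tsupp St; have := psi_star_nearer f_pdf tsupp W_loss W_lim0
  (fun m => @l_u_bounds t m tsupp) St.
move=> /lt_le_trans; apply; rewrite -[leLHS]adde0 leeD//.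
  rewrite /fiber_mass.
  have -> // : fiber N t = [set s | W (s - psi' t) < W (s - psi t)].
  by apply/seteqP; split=> s; rewrite /fiber /N/= !lossE.
by rewrite mule_ge0 ?fiber_mass_ge0 ?lee_fin.
Qed.

(** Where the density of D vanishes the bound is trivial; on [S] it is the strict one; off [S]
    clamping changes nothing, so the whole fiber is a tie and contributes exactly one half. *)
Let h_ge_half t : (pdfD f lam t < +oo)%E ->
  ((2^-1)%:E * pdfD f lam t <= h t)%E.
Proof.
move=> pt; have [p0|p0] := leP (pdfD f lam t) 0%E.
  apply: (@le_trans _ _ 0%E); first by rewrite mule_ge0_le0// lee_fin.
  by rewrite adde_ge0 ?mule_ge0 ?fiber_mass_ge0 ?lee_fin.
have [st|St] := boolP (l t <= (psi t)%:E <= u t)%E; last first.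
  by apply/ltW/h_gt_half => //; rewrite /suppD/= p0.
rewrite -[leLHS]add0e leeD ?fiber_mass_ge0//.
rewrite /fiber_mass; have -> // : fiber E t = setT.
by apply/seteqP; split=> // s _; rewrite /fiber /E/= !lossE /psi' psi_star_id.
Qed.

Let mDS : measurable ((@diff21 R) @^-1` S : set R2).
Proof. by rewrite -[X in measurable X]setTI; exact: measurable_diff21. Qed.

(** Disintegrates the probability that [psi] leaves the bounds, which is positive by [psi_out]. *)
Let out_gt0 : (0 < \int[mu]_t fiber_mass ((@diff21 R) @^-1` S) t)%E.
Proof.
have mXD : measurable (X @^-1` ((@diff21 R) @^-1` S)).
  by have [mX _] := X_density; rewrite -[X in measurable X]setTI; exact: mX.
rewrite -law_fiber_mass// -(setCK (X @^-1` _)) probability_setC;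
  last exact: measurableC.
rewrite sube_gt0; apply: le_lt_trans psi_out; rewrite le_eqVlt; apply/orP; left.
apply/eqP; congr (P th _); apply/seteqP; split=> w /=; first by move/negP/negPn.
by move=> lu; apply/negP/negPn.
Qed.

Let integral_pdfD : (\int[mu]_t pdfD f lam t = 1)%E.
Proof.
transitivity (\int[mu]_t fiber_mass setT t)%E; first by [].
by rewrite -law_fiber_mass// preimage_setT probability_setT.
Qed.

Lemma GPN_psi_star_gt_half :
  ((2^-1)%:E < GPN P X W (delta (psi_star l u psi)) (delta psi) th)%E.
Proof.
(* If the GPN were at most 1/2, then [h], being almost everywhere at least half the density of D,
   would equal it almost everywhere. *)
rewrite GPN_h ltNge; apply/negP => hle.
have ip : mu.-integrable [set: R1] (pdfD f lam).
  exact: (integrable_fiber_mass measurableT).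
have p_lty : {ae mu, forall t : R1, (pdfD f lam t < +oo)%E}.
  have := integrable_ae measurableT ip.
  by apply: filterS => t /(_ I); rewrite ge0_fin_numE// (fiber_mass_ge0 setT).
have ph : {ae mu, forall t : R1, ((2^-1)%:E * pdfD f lam t = h t)%E}.
  apply: integral_le_ae_eq => //; first exact: integrableZl.
  - by apply: filterS p_lty => t; exact: h_ge_half.
  - rewrite (le_trans hle)// ge0_integralZl_EFin//.
    + by rewrite integral_pdfD mule1.
    + by move=> t _; exact: (fiber_mass_ge0 setT).
    + exact: measurable_int ip.
have := out_gt0.
rewrite (ge0_ae_eq_integral (g := cst 0%E) measurableT)//.
- by rewrite integral0 ltxx.
- exact: measurable_fiber_mass.
- by move=> t _; exact: fiber_mass_ge0.
(* The event that D lies in [S] has, as fiber over t, everything or nothing. For t in [S] a positive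
   density would contradict [hE] through the strict bound, so the fiber mass is 0 and the event is
   null. *)
apply: filterS2 p_lty ph => t pty hE _.
have fiberE s : fiber ((@diff21 R) @^-1` S) t s = S t.
  rewrite /fiber/= /diff21/=.
  by have -> : s + th.1 + t - (s + th.1) = t by lra.
have [St|St] := pselect (S t); last first.
  rewrite /fiber_mass [X in integral _ X](_ : _ = set0) ?integral_set0//.
  by apply/seteqP; split=> // s; rewrite fiberE.
rewrite /fiber_mass [X in integral _ X](_ : _ = setT); last first.
  by apply/seteqP; split=> // s _; rewrite fiberE.
have [p0|p0] := leP (pdfD f lam t) 0%E.
  by apply/eqP; rewrite eq_le p0 (fiber_mass_ge0 setT).
have tsupp : suppD f lam t by rewrite /suppD/= p0.
by have := h_gt_half tsupp St; rewrite hE ltxx.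
Qed.

End law.

Theorem theorem3p1p1 (R : realType) (d : measure_display)
    (T : measurableType d) (P : R * R -> probability T R) (X : T -> R * R)
    (f : R * R -> R) (W : R -> R) (psi : R -> R) (l u : R -> \bar R)
    (f_pdf : is_pdf2 f)
    (X_density : has_location_density P X f)
    (W_loss : general_loss W)
    (W_lim0 : exists c : R, W x @[x --> 0^'] --> c)
    (psi_meas : measurable_fun [set: measurableTypeR R] psi)
    (l_meas : measurable_fun [set: measurableTypeR R] l)
    (u_meas : measurable_fun [set: measurableTypeR R] u)
    (l_u_bounds : forall lam t m : R, 0 <= lam -> suppD f lam t ->
       is_cond_median f lam t m -> (l t <= m%:E <= u t)%E)
    (psi_out : forall th, Theta0 th ->
       (P th [set w | (l (diff21 (X w)) <= (psi (diff21 (X w)))%:E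
                       <= u (diff21 (X w)))%E] < 1)%E) :
  pitman_nearer P X W (delta (psi_star l u psi)) (delta psi).

Proof.
(* Strictness at every theta gives both clauses of the criterion; ordered parameters make [lam]
   nonnegative, as the bounds on medians require. *)
have gt_half th : Theta0 th ->
    ((2^-1)%:E < GPN P X W (delta (psi_star l u psi)) (delta psi) th)%E.
  move=> th0; apply: (GPN_psi_star_gt_half f_pdf X_density) => //.
    by move=> t m; apply: l_u_bounds; rewrite subr_ge0.
  exact: psi_out.
split=> [th /gt_half/ltW//|].
by exists (0, 0); [|apply: gt_half]; rewrite /Theta0/=.
Qed.
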